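(* Let $T=(T_1,\dots,T_n)\in\mathcal B(\mathcal H)^n$ be an $n$-tuple of commuting contractions on a Hilbert space $\mathcal H$ and let $\gamma\in\mathbb Z_+^n$ with $\gamma\ge\mathbf e=(1,\dots,1)$. Then the following are equivalent. (a) $T$ is a $\gamma$-contractive multi-operator. (b) $T$ is a $\mathcal W_\gamma$-hypercontraction.
   Context: $\mathbb Z_+=\{0,1,2,\dots\}$; inequalities between multi-indices are componentwise; $T^\alpha=T_1^{\alpha_1}\cdots T_n^{\alpha_n}$, $|\alpha|=\sum\alpha_i$, $\alpha!=\prod\alpha_i!$. $T$ is a $\gamma$-contractive multi-operator if for every $\beta\in\mathbb Z_+^n$ with $0\le\beta\le\gamma$, $$K_{\mathcal W_\beta}^{-1}(T,T^* )=\sum_{0\le\alpha\le\beta}(-1)^{|\alpha|}\frac{\beta!}{\alpha!(\beta-\alpha)!}T^\alpha T^{*\alpha}\ge0 .$$ $\mathcal W_\gamma=(\omega_{\gamma_1},\dots,\omega_{\gamma_n})$ where $\omega_{\gamma_i}=\big\{1/\binom{\gamma_i+l-1}{l}\big\}_{l\ge0}$. Let $\mathds 1$ be the constant sequence $1$. For a tuple $\mathcal W=(\omega_1,\dots,\omega_n)$ of such sequences, $\omega_i=\{\omega^{(i)}_m\}_{m\ge0}$, put $k_{\mathcal W}(\boldsymbol z)=\sum_{\alpha\in\mathbb Z_+^n}\frac{\boldsymbol z^\alpha}{\omega^{(1)}_{\alpha_1}\cdots\omega^{(n)}_{\alpha_n}}$ on $\mathbb D^n$, $\frac1{k_{\mathcal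 W}(\boldsymbol z)}=\sum_\alpha c_\alpha\boldsymbol z^\alpha$, and for $\mathbf r\in(0,1)^n$, $D_{\mathcal W,T}(\mathbf r)=\sum_\alpha c_\alpha\mathbf r^\alpha T^\alpha T^{*\alpha}$. (For $\mathcal W=\mathcal W_\gamma$ one has $k_{\mathcal W_\gamma}(\boldsymbol z)=\prod_i(1-z_i)^{-\gamma_i}$.) With $S(\mathcal W)=\{(\omega_1',\dots,\omega_n'):\omega_i'\in\{\omega_i,\mathds 1\}\}$, the commuting tuple of contractions $T$ is a $\mathcal W$-hypercontraction if $D_{\mathcal W',T}(\mathbf r)\ge0$ for all $\mathcal W'\in S(\mathcal W)$ and all $\mathbf r\in(0,1)^n$. *)

(* Defs.v *)
From HB Require Import structures.
From mathcomp Require Import all_boot all_order all_algebra finmap.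
From mathcomp Require Import complex.
From mathcomp Require Import boolp classical_sets functions cardinality fsbigop.
From mathcomp Require Import reals topology normedtype.

Set Implicit Arguments.
Unset Strict Implicit.
Unset Printing Implicit Defensive.

Import Order.TTheory GRing.Theory Num.Theory.
Import numFieldNormedType.Exports.

Local Open Scope classical_set_scope.
Local Open Scope ring_scope.

Section UnconditionalSum.
Variables (K : numFieldType) (I : choiceType) (V : normedModType K).

(* The finite partial sums converge to [s] along the net of finite subsets of
   [I]; for scalar families this is the same as absolute convergence. *)
Definition is_usum (f : I -> V) (s : V) : Prop :=
  forall e : K, 0 < e -> exists A : {fset I}, forall B : {fset I},
    (A `<=` B)%fset -> `|\sum_(a <- B) f a - s| < e.

(* Equal to 0 when the family is not summable. *)
Definition usum (f : I -> V) : V := xget 0 [set s | is_usum f s].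

End UnconditionalSum.

Notation mindex n := {ffun 'I_n -> nat}.

Section MultiIndex.
Variable n : nat.
Implicit Types a b : mindex n.

Definition mle a b : Prop := forall i, (a i <= b i)%N.
Definition mabs a : nat := (\sum_i a i)%N.
Definition mfact a : nat := (\prod_i (a i)`!)%N.
Definition msub a b : mindex n := [ffun i => (a i - b i)%N].

Definition mpow (K : pzSemiRingType) (z : 'I_n -> K) a : K :=
  \prod_i z i ^+ a i.

(* The factors are composed in the order T_1^(a_1) ... T_n^(a_n). *)
Definition opow (H : Type) (T : 'I_n -> H -> H) a : H -> H :=
  \big[comp/idfun]_(i < n) iter (a i) (T i).

End MultiIndex.

Section Weights.
Variables (R : realType) (n : nat).
Implicit Type W : 'I_n -> nat -> R.

Definition polydisc : set ('I_n -> R[i]) := [set z | forall i, `|z i| < 1].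

Definition wkernel W (z : 'I_n -> R[i]) : R[i] :=
  usum (fun a : mindex n =>
    (mpow z a / (\prod_i W i (a i))%:C%C : R[i]^o)).

(* [c] is the family of Taylor coefficients of 1 / k_W on the polydisc. The
   condition [wkernel W z != 0] also excludes a divergent series, because [usum]
   is then 0. *)
Definition is_reciprocal_coeff W (c : mindex n -> R[i]) : Prop :=
  forall z, polydisc z -> wkernel W z != 0 /\
    is_usum (fun a => (c a * mpow z a : R[i]^o)) (wkernel W z)^-1.

Definition reciprocal_coeff W : mindex n -> R[i] :=
  xget (fun=> 0) [set c | is_reciprocal_coeff W c].

Definition weight (g : mindex n) : 'I_n -> nat -> R :=
  fun i l => ('C(g i + l - 1, l)%:R)^-1.

Definition weight_choices W : set ('I_n -> nat -> R) :=
  [set W' | forall i, W' i = W i \/ W' i = (fun=> 1)].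

End Weights.

Section Operators.
Variables (R : realType) (H : completeNormedModType R[i]).
Variable dot : {dot H for Num.conj}.

Definition contractive_op (A : H -> H) : Prop := forall x, `|A x| <= `|x|.

Definition positive_op (A : H -> H) : Prop := forall x, 0 <= dot (A x) x.

(* For a bounded linear [A] on a Hilbert space such a map [B] exists, by the Riesz
   representation theorem, and is unique. *)
Definition adjoint (A : H -> H) : H -> H :=
  xget (fun=> 0) [set B : H -> H | forall x y, dot (A x) y = dot x (B y)].

Variables (n : nat) (T : 'I_n -> {linear H -> H}).

Definition opow_adj (a : mindex n) : H -> H :=
  opow (fun i => T i : H -> H) a \o opow (fun i => adjoint (T i)) a.

Definition defect (b : mindex n) : H -> H := fun x =>
  \sum_(a \in [set a : mindex n | mle a b])
    ((-1) ^+ mabs a * ((mfact b)%:R / (mfact a * mfact (msub b a))%:R))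
      *: opow_adj a x.

Definition contractive_multioperator (g : mindex n) : Prop :=
  forall b : mindex n, mle b g -> positive_op (defect b).

(* D_{W,T}(r), the series being summed pointwise on [H]. When the
   [T i] are commuting contractions it converges absolutely in operator norm,
   because [r] lies in the polydisc, so the pointwise sum is the norm sum. *)
Definition weighted_defect (W : 'I_n -> nat -> R) (r : 'I_n -> R) : H -> H :=
  fun x => usum (fun a : mindex n =>
    (reciprocal_coeff W a * (mpow r a)%:C%C) *: opow_adj a x).

Definition hypercontraction (W : 'I_n -> nat -> R) : Prop :=
  forall W', weight_choices W W' ->
  forall r : 'I_n -> R, (forall i, 0 < r i < 1) ->
    positive_op (weighted_defect W' r).

End Operators.

(* Main.v *)
(* Put a_x(alpha) = |T^{*alpha} x|^2, a bounded nonnegative function on Z_+^n, and let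
   S_i be the shift in the i-th index, so that S^eta a_x = a_{T^{*eta} x}. Then
   <K_{W_beta}^{-1}(T,T^* ) x, x> is the value at 0 of prod_i (1 - S_i)^(beta_i) a_x.
   As 1 / k_W is a polynomial for W in S(W_gamma), with Taylor coefficients determined
   by its values on the polydisc, <D_{W,T}(r) x, x> is the value at 0 of
   prod_i (1 - r_i S_i)^(d_i) a_x, where d_i is gamma_i or 1.

   (a) => (b): 1 - r S = (1 - r) + r (1 - S), so the second expression is a combination
   of the first ones with nonnegative coefficients.

   (b) => (a): if g is bounded, 0 < r < 1 and (1 - r S_i) g >= 0, then
   g >= r S_i g >= r^2 S_i^2 g >= ..., hence g >= 0. This lowers the exponents from
   gamma to any beta <= gamma one step at a time, and then r tends to 1. *)
Require Import Defs.
From mathcomp Require Import all_boot all_order all_algebra finmap.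
From mathcomp Require Import complex.
From mathcomp Require Import boolp classical_sets fsbigop.
From mathcomp Require Import interval_inference reals topology normedtype sequences.
From mathcomp Require derive.
From mathcomp Require Import ring.

Set Implicit Arguments.
Unset Strict Implicit.
Unset Printing Implicit Defensive.

Import Order.TTheory GRing.Theory Num.Theory.
Import numFieldNormedType.Exports.
Local Open Scope ring_scope.

(** * Adjoints of contractions *)

Section HilbertSpace.
Variables (R : realType) (H : completeNormedModType R[i]).
Variable dot : {dot H for Num.conj}.
Hypothesis dot_norm : forall x : H, dot x x = `|x| ^+ 2.

(** A positive element of [R[i]] is real, so the Archimedean property of [R] applies to its real
    part. *)
Lemma invn_small (e : R[i]) : 0 < e -> exists k : nat, k.+1%:R^-1 < e.
Proof.
move=> e0; have eR : e = (complex.Re e)%:C%C by rewrite RRe_real // gtr0_real.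
have e0' : 0 < complex.Re e by rewrite eR ltcR in e0.
have [k _ /(_ k (leqnn k)) /= kP] := near_infty_natSinv_lt (PosNum e0').
exists k; rewrite eR -[k.+1%:R](rmorph_nat (real_complex R)) -fmorphV.
by rewrite ltcR.
Qed.

Lemma seq_complete (w : nat -> H) :
  (forall j k : nat, `|w j - w k| <= j.+1%:R^-1 + k.+1%:R^-1) ->
  exists z, forall e : R[i], 0 < e -> exists k : nat, `|z - w k| < e /\ k.+1%:R^-1 < e.
Proof.
move=> wC.
have small (e : R[i]) : 0 < e ->
    exists N : nat, forall k : nat, (N <= k)%N -> k.+1%:R^-1 < e.
  move=> /invn_small[N NP]; exists N => k Nk; apply: le_lt_trans NP.
  by rewrite lef_pV2 ?posrE ?ltr0n // ler_nat.
have : cauchy (w x @[x --> \oo])%classic.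
  apply: cauchy_exP => e e0.
  have [N NP] := small (e / 2) (divr_gt0 e0 (ltr0Sn _ 1)).
  exists (w N); exists N => // k /= Nk; rewrite -ball_normE /=.
  by apply: le_lt_trans (wC _ _) _; rewrite [e]splitr ltrD // NP.
move=> /cauchy_cvg /cvg_ex[z /cvgrPdist_lt zP].
exists z => e e0; have [N1 _ N1P] := zP e e0; have [N2 N2P] := small e e0.
exists (maxn N1 N2); split; first by apply: N1P; rewrite /= leq_maxl.
by rewrite N2P // leq_maxr.
Qed.

(** Expanding the squared norm of |y|^2 x - <x,y> y gives |y|^2 (|x|^2 |y|^2 - |<x,y>|^2), which is
    therefore nonnegative. *)
Lemma cauchy_schwarz x y : `|dot x y| <= `|x| * `|y|.
Proof.
have [->|y0] := eqVneq y 0; first by rewrite linear0r normr0 mulr_ge0.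
have ny : 0 < `|y| ^+ 2 by rewrite exprn_gt0 ?normr_gt0.
have := dnorm_ge0 dot (`|y| ^+ 2 *: x - dot x y *: y).
rewrite dnormB !dnormZ !dot_norm !linearZl_LR !linearZr_LR /=.
rewrite !rmorphM /= conjCK (conj_Creal (normr_real y)) -expr2.
rewrite [(dot x y)^* * _]mulrC -!normCK normrX normr_id => h.
rewrite -ler_sqr ?nnegrE ?mulr_ge0 // -(ler_pM2l ny) -subr_ge0.
by apply: le_trans h _; rewrite le_eqVlt; apply/orP; left; apply/eqP; ring.
Qed.

(* At an e^2-minimizer w of J w = |w|^2 - 2 Re (l w), moving w along x cannot lower J
   by more than e^2; the best multiple of x lowers it by |dot x w - l x|^2 / |x|^2. *)
Lemma near_minimizer (M : R[i]) (l : H -> R[i]) (e : R[i]) :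
    0 <= M -> 0 < e ->
    (forall a u v, l (a *: u + v) = a * l u + l v) ->
    (forall x, `|l x| <= M * `|x|) ->
  exists w, forall x, `|dot x w - l x| <= e * `|x|.
Proof.
move=> M0 e0 lin lM.
pose J w : R[i] := `|w| ^+ 2 - (l w + (l w)^*).
have JR w : J w \is Num.real.
  rewrite rpredB ?rpredX ?normr_real //.
  by apply/CrealP; rewrite rmorphD /= conjCK addrC.
have JE w : J w = (complex.Re (J w))%:C%C by rewrite RRe_real.
(* As 2 Re (l w) <= 2 M |w|, one has J w + M^2 >= (|w| - M)^2. *)
have Jlb w : - M ^+ 2 <= J w.
  have lw : l w + (l w)^* <= 2 * M * `|w|.
    apply: le_trans (real_ler_norm _) _.
      by apply/CrealP; rewrite rmorphD /= conjCK addrC.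
    apply: le_trans (ler_normD _ _) _.
    by rewrite norm_conjC -mulrA mulr2n mulrDl mul1r lerD.
  rewrite -subr_ge0 opprK.
  apply: le_trans (_ : 0 <= (`|w| - M) ^+ 2) _.
    by rewrite -realEsqr rpredB ?normr_real ?ger0_real.
  rewrite -subr_ge0 in lw; rewrite -subr_ge0; apply: le_trans lw _.
  by rewrite le_eqVlt; apply/orP; left; apply/eqP; rewrite /J; ring.
pose E : set R := [set complex.Re (J w) | w in [set: H]]%classic.
have Einf : has_inf E.
  split; first by exists (complex.Re (J 0)), 0.
  exists (complex.Re (- M ^+ 2)) => _ [w _ <-].
  rewrite -lecR -JE RRe_real //.
  by rewrite rpredN rpredX // ger0_real.
have eR : e = (complex.Re e)%:C%C by rewrite RRe_real // gtr0_real.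
have [|_ [w _ <-] wP] := @inf_adherent _ E (complex.Re e ^+ 2) _ Einf.
  by rewrite exprn_gt0 // -ltcR -eR.
exists w => x; have [->|x0] := eqVneq x 0.
  rewrite linear0l normr0 mulr0 sub0r normrN.
  by apply: le_trans (lM _) _; rewrite normr0 mulr0.
have nx : 0 < `|x| ^+ 2 by rewrite exprn_gt0 ?normr_gt0.
set d := dot x w - l x.
have Jmin v : J w - e ^+ 2 <= J v.
  rewrite lerBlDr JE [J v]JE eR -rmorphXn -rmorphD lecR.
  apply: le_trans (ltW wP) _; rewrite lerD2r.
  by apply: ge_inf; [case: Einf | exists v].
have JP : J (- (d^* / `|x| ^+ 2) *: x + w) = J w - `|d| ^+ 2 / `|x| ^+ 2.
  have ncx : (`|x| ^+ 2)^* = `|x| ^+ 2.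
    by rewrite conj_Creal // rpredX ?normr_real.
  have dE : dot x w = d + l x by rewrite /d subrK.
  clearbody d; rewrite /J lin -!dot_norm dnormD !linearZl_LR !linearZr_LR /= !dot_norm.
  rewrite dE !rmorphD /= !rmorphM /= !rmorphN /= !rmorphM /= !fmorphV /=.
  rewrite conjCK ncx rmorphD /= normCK; field.
  by rewrite normr_eq0.
have := Jmin (- (d^* / `|x| ^+ 2) *: x + w); rewrite JP lerD2l lerN2.
rewrite ler_pdivrMr // -exprMn ler_sqr ?nnegrE ?mulr_ge0 //; exact: ltW.
Qed.

(** Take w_k representing l up to 1/(k+1). Evaluating two approximations at x = w_j - w_k cancels l
    x and leaves |x|^2 <= (1/(j+1) + 1/(k+1)) |x|, so the w_k converge, and the limit represents l
    exactly. *)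
Lemma riesz (M : R[i]) (l : H -> R[i]) :
    0 <= M -> (forall a u v, l (a *: u + v) = a * l u + l v) ->
    (forall x, `|l x| <= M * `|x|) ->
  exists z, forall x, l x = dot x z.
Proof.
move=> M0 lin lM.
have /choice[w wP] (k : nat) :
    exists w, forall x, `|dot x w - l x| <= k.+1%:R^-1 * `|x|.
  by apply: near_minimizer lin lM => //; rewrite invr_gt0 ltr0n.
have [j k|z zP] := @seq_complete w.
  set x := w j - w k.
  have [->|x0] := eqVneq x 0; first by rewrite normr0 addr_ge0 ?invr_ge0.
  have : `|dot x x| <= (j.+1%:R^-1 + k.+1%:R^-1) * `|x|.
    rewrite {2}/x linearBr mulrDl.
    have -> : dot x (w j) - dot x (w k) = (dot x (w j) - l x) - (dot x (w k) - l x).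
      by ring.
    by apply: le_trans (ler_normB _ _) _; rewrite lerD.
  by rewrite dot_norm normrX normr_id expr2 ler_pM2r ?normr_gt0.
exists z => x; apply/eqP; rewrite -subr_eq0 -normr_le0; apply/ler_addgt0Pr => e e0.
rewrite add0r.
(* Adding 1 keeps the denominator positive when x = 0. *)
have x1 : 0 < `|x| + 1 by rewrite ltr_wpDl ?normr_ge0.
have e2 : 0 < e / 2 / (`|x| + 1) by rewrite !divr_gt0.
have [k [zk kk]] := zP _ e2.
have -> : l x - dot x z = - (dot x (w k) - l x) - dot x (z - w k).
  by rewrite linearBr; ring.
apply: le_trans (ler_normB _ _) _; rewrite normrN [e]splitr.
have xe (c : R[i]) : c <= e / 2 / (`|x| + 1) -> c * `|x| <= e / 2.
  move=> ce; apply: le_trans (ler_wpM2r (normr_ge0 x) ce) _.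
  rewrite mulrAC ler_pdivrMr // ler_pM2l ?divr_gt0 //.
  by rewrite lerDl.
rewrite lerD //; first by apply: le_trans (wP _ _) _; apply/xe/ltW.
by apply: le_trans (cauchy_schwarz _ _) _; rewrite mulrC; apply/xe/ltW.
Qed.

Section Contraction.
Variable A : {linear H -> H}.
Hypothesis A_contraction : contractive_op A.

(** Riesz representation of x' |-> <A x', y'> shows that the choice defining [adjoint] is not its
    default value. *)
Lemma adjointP x y : dot (A x) y = dot x (adjoint dot A y).
Proof.
have ex (y' : H) : exists z, forall x', dot (A x') y' = dot x' z.
  apply: (@riesz `|y'|) => // [a u v|u].
    by rewrite linearP linearDl linearZl_LR.
  apply: le_trans (cauchy_schwarz _ _) _; rewrite mulrC.
  by rewrite ler_wpM2l ?A_contraction.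
have [B BP] := choice ex.
have adj : exists B : H -> H, [set B : H -> H |
    forall x y, dot (A x) y = dot x (B y)]%classic B by exists B.
exact: (xgetPex (fun=> 0) adj).
Qed.

(** With z = A^* y, |z|^2 = <A z, y> <= |z| |y|. *)
Lemma adjoint_contraction : contractive_op (adjoint dot A).
Proof.
move=> y; set z := adjoint dot A y.
have [->|z0] := eqVneq z 0; first by rewrite normr0.
rewrite -(ler_pM2l (_ : 0 < `|z|)) ?normr_gt0 //.
have -> : `|z| * `|z| = `|dot z z| by rewrite dot_norm normrX normr_id.
rewrite {2}/z -adjointP; apply: le_trans (cauchy_schwarz _ _) _.
by rewrite ler_wpM2r ?A_contraction.
Qed.

End Contraction.

Lemma dot_inj y z : (forall x, dot x y = dot x z) -> y = z.
Proof.
move=> yz; apply/eqP; rewrite -subr_eq0 -(dnorm_eq0 dot).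
by rewrite linearBr /= yz subrr.
Qed.

Lemma adjoint_comm (A B : {linear H -> H}) :
    contractive_op A -> contractive_op B -> (forall x, A (B x) = B (A x)) ->
  forall x, adjoint dot A (adjoint dot B x) = adjoint dot B (adjoint dot A x).
Proof.
move=> cA cB AB x; apply: dot_inj => y.
by rewrite -(adjointP cA) -(adjointP cB) -(adjointP cB) -(adjointP cA) AB.
Qed.

End HilbertSpace.

(** * Commuting powers *)

Lemma maddE n (a b : mindex n) i : (a + b) i = (a i + b i)%N.
Proof. by rewrite ffunE. Qed.

Section CommutingFamilies.
Variables (H : Type) (n : nat) (F : 'I_n -> H -> H).
Hypothesis F_comm : forall i j x, F i (F j x) = F j (F i x).

Lemma iter_comm i j k l y :
  iter k (F i) (iter l (F j) y) = iter l (F j) (iter k (F i) y).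
Proof.
elim: k => //= k ->; move: (iter k _ _) => z.
by elim: l => //= l <-; rewrite F_comm.
Qed.

Lemma big_iter_comm (s : seq 'I_n) (a : mindex n) i k y :
  (\big[comp/idfun]_(j <- s) iter (a j) (F j)) (iter k (F i) y) =
    iter k (F i) ((\big[comp/idfun]_(j <- s) iter (a j) (F j)) y).
Proof.
elim: s => [|j s IH]; first by rewrite !big_nil.
by rewrite big_cons /= IH iter_comm.
Qed.

Lemma opowD (a b : mindex n) x : opow F (a + b) x = opow F a (opow F b x).
Proof.
rewrite /opow; elim: (index_enum _) => [|i s IH]; first by rewrite !big_nil.
by rewrite !big_cons /= IH big_iter_comm maddE iterD.
Qed.

End CommutingFamilies.

(** * Squared norms along the powers of the adjoints *)

Section OperatorPowers.
Variables (R : realType) (H : completeNormedModType R[i]).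
Variable dot : {dot H for Num.conj}.
Hypothesis dot_norm : forall x : H, dot x x = `|x| ^+ 2.
Variables (n : nat) (T : 'I_n -> {linear H -> H}).
Hypothesis T_contraction : forall i, contractive_op (T i).
Hypothesis T_comm : forall i j (x : H), T i (T j x) = T j (T i x).

Let Ts i : H -> H := adjoint dot (T i).

Lemma opow_contraction (F : 'I_n -> H -> H) (a : mindex n) :
  (forall i, contractive_op (F i)) -> contractive_op (opow F a).
Proof.
move=> Fc; rewrite /opow; elim: (index_enum _) => [|i s IH] x; first by rewrite big_nil.
rewrite big_cons /=; apply: le_trans (IH x).
by elim: (a i) => //= k; apply: le_trans; apply: Fc.
Qed.

Lemma Ts_comm i j x : Ts i (Ts j x) = Ts j (Ts i x).
Proof. exact: adjoint_comm. Qed.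

(** Taking adjoints reverses the order of the factors; commutation of the adjoints restores it. *)
Lemma opow_adjoint (a : mindex n) x y :
  dot (opow (fun i => T i : H -> H) a x) y = dot x (opow Ts a y).
Proof.
have itA i k z t : dot (iter k (T i) z) t = dot z (iter k (Ts i) t).
  by elim: k t => //= k IH t; rewrite adjointP // IH -iterSr.
rewrite /opow; elim: (index_enum _) y => [|i s IH] y; first by rewrite !big_nil.
by rewrite !big_cons /= itA IH (big_iter_comm Ts_comm).
Qed.

(** The function a_x of the introduction. The real part moves it from [R[i]] to [R], where limits
    and order arguments take place. *)
Definition adj_norm2 (x : H) (a : mindex n) : R := complex.Re (`|opow Ts a x| ^+ 2).

Lemma adj_norm2E x a : (adj_norm2 x a)%:C%C = `|opow Ts a x| ^+ 2.
Proof. by rewrite RRe_real // rpredX // normr_real. Qed.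

Lemma dot_opow_adj a x : dot (opow_adj dot T a x) x = (adj_norm2 x a)%:C%C.
Proof. by rewrite adj_norm2E -dot_norm /opow_adj /= opow_adjoint. Qed.

Lemma adj_norm2_ge0 x a : 0 <= adj_norm2 x a.
Proof. by rewrite -ler0c adj_norm2E exprn_ge0. Qed.

Lemma adj_norm2_bound x a : adj_norm2 x a <= adj_norm2 x 0.
Proof.
rewrite -lecR !adj_norm2E ler_sqr ?nnegrE //.
have -> : opow Ts 0 x = x.
  rewrite /opow; elim: (index_enum _) => [|i s IH]; first by rewrite big_nil.
  by rewrite big_cons /= IH ffunE.
by apply: opow_contraction => i; apply: adjoint_contraction.
Qed.

Lemma adj_norm2D x a b : adj_norm2 x (a + b) = adj_norm2 (opow Ts a x) b.
Proof. by rewrite /adj_norm2 addrC (opowD Ts_comm). Qed.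

End OperatorPowers.

(** * Multi-index differences *)

Lemma eq_sum_support (I : choiceType) (V : nmodType) (g : I -> V) (s t : seq I) :
    uniq s -> uniq t -> (forall a, g a != 0 -> (a \in s) && (a \in t)) ->
  \sum_(a <- s) g a = \sum_(a <- t) g a.
Proof.
move=> us ut st.
rewrite (bigID (fun a => g a != 0)) /= [in RHS](bigID (fun a => g a != 0)) /=.
rewrite [X in _ + X]big1 ?[X in _ = _ + X]big1 => [|a /negPn/eqP|a /negPn/eqP] //.
rewrite !addr0 -[LHS]big_filter -[RHS]big_filter; apply: perm_big.
apply: uniq_perm; rewrite ?filter_uniq // => a; rewrite !mem_filter.
by case: (boolP (g a != 0)) => //= /st/andP[-> ->].
Qed.

(** * Finite cubes of multi-indices *)

Section Boxes.
Variable n : nat.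
Implicit Types (a b d : mindex n) (m : nat).

(** One cube, large enough for all exponents in play, serves as common range of summation:
    coefficients vanish off their support, and sums of products over a cube factor. *)
Definition box m : seq (mindex n) :=
  [seq [ffun i => f i : nat] | f : {ffun 'I_n -> 'I_m.+1}].

Lemma mem_box m a : (a \in box m) = [forall i, (a i <= m)%N].
Proof.
apply/mapP/forallP => [[f _ ->] i|am]; first by rewrite ffunE -ltnS.
exists [ffun i => inord (a i)]; rewrite ?mem_enum //; apply/ffunP => i.
by rewrite !ffunE inordK // ltnS.
Qed.

Lemma box_uniq m : uniq (box m).
Proof.
rewrite map_inj_uniq ?enum_uniq // => f g /ffunP fg.
by apply/ffunP => i; have := fg i; rewrite !ffunE => /val_inj.
Qed.

Lemma subset_box (s : seq (mindex n)) : exists m, {subset s <= box m}.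
Proof.
elim: s => [|a s [m sm]]; first by exists 0%N.
exists (maxn m (\max_i a i)) => b; rewrite inE => /orP[/eqP-> | /sm].
  rewrite mem_box; apply/forallP => i.
  by rewrite leq_max (leq_bigmax i) orbT.
rewrite !mem_box => /forallP bm; apply/forallP => i.
by rewrite leq_max bm.
Qed.

Lemma sum_box_prod (K : comPzSemiRingType) (G : 'I_n -> nat -> K) m :
  \sum_(a <- box m) \prod_i G i (a i) = \prod_i \sum_(j < m.+1) G i j.
Proof.
rewrite big_image /= bigA_distr_bigA /=; apply: eq_bigr => f _.
by apply: eq_bigr => i _; rewrite ffunE.
Qed.

End Boxes.

(** * Coefficients of products of damped differences *)

Section DifferenceCoefficients.
Variables (n : nat) (K : comNzRingType).
Implicit Types (a b d : mindex n) (r : 'I_n -> K).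

(** The coefficient of z^a in prod_i (1 - r_i z_i)^(d_i). *)
Definition diff_coeff d r a : K := \prod_i ((- r i) ^+ a i *+ 'C(d i, a i)).

Lemma diff_coeff_neq0 d r a : diff_coeff d r a != 0 -> mle a d.
Proof.
move=> + i; apply: contraNT; rewrite -ltnNge => da; apply/eqP.
by rewrite /diff_coeff (bigD1 i) //= bin_small // mulr0n mul0r.
Qed.

Lemma coef_lin_exp (c : K) k j : ((1 + c%:P * 'X) ^+ k)`_j = c ^+ j *+ 'C(k, j).
Proof.
rewrite exprDn coef_sum.
have E (i : 'I_k.+1) : ((1 ^+ (k - i) * (c%:P * 'X) ^+ i) *+ 'C(k, i))`_j =
    if j == i :> nat then c ^+ j *+ 'C(k, j) else 0.
  rewrite expr1n mul1r exprMn -rmorphXn /= coefMn coefCM coefXn.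
  by case: eqP => [->|_]; rewrite ?mulr1 // mulr0 mul0rn.
under eq_bigr do rewrite E.
rewrite -big_mkcond /=; have [kj|jk] := ltnP k j.
  rewrite bin_small // mulr0n big1 // => i /eqP ji.
by rewrite (big_pred1 (Ordinal (jk : (j < k.+1)%N))).
Qed.

(** Compare the coefficients of X^j in (1 - t X)^k = ((1 - t) + t (1 - X))^k. Terms with l > k
    vanish, so the range may extend to any m >= k. *)
Lemma diff_coeff_mix1 (t : K) k m j : (k <= m)%N ->
  (- t) ^+ j *+ 'C(k, j) =
  \sum_(l < m.+1) ((1 - t) ^+ (k - l) * t ^+ l *+ 'C(k, l)) * ((- 1) ^+ j *+ 'C(l, j)).
Proof.
move=> km; rewrite -coef_lin_exp.
have -> : 1 + (- t)%:P * 'X = (1 - t)%:P + t%:P * (1 + (-1)%:P * 'X) :> {poly K}.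
  by rewrite !rmorphN !rmorphB /=; ring.
rewrite exprDn coef_sum.
rewrite (big_ord_widen m.+1 (fun l => (((1 - t)%:P ^+ (k - l) *
  (t%:P * (1 + (-1)%:P * 'X)) ^+ l) *+ 'C(k, l))`_j)) //.
rewrite big_mkcond /=; apply: eq_bigr => l _; case: ifP => [_|/negbT].
  rewrite exprMn mulrA -!rmorphXn -rmorphM /= coefMn coefCM coef_lin_exp.
  by rewrite mulrnAl.
by rewrite -leqNgt => kl; rewrite [in RHS]bin_small // mulr0n mul0r.
Qed.

Lemma diff_coeff_mix d r a m : (forall i, d i <= m)%N ->
  diff_coeff d r a = \sum_(b <- box n m)
    (\prod_i ((1 - r i) ^+ (d i - b i) * r i ^+ b i *+ 'C(d i, b i))) *
    diff_coeff b (fun=> 1) a.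
Proof.
move=> dm; rewrite /diff_coeff; under [RHS]eq_bigr do rewrite -big_split /=.
rewrite (sum_box_prod (fun i l => ((1 - r i) ^+ (d i - l) * r i ^+ l *+ 'C(d i, l)) *
  ((- 1) ^+ a i *+ 'C(l, a i)))).
by apply: eq_bigr => i _; apply: diff_coeff_mix1.
Qed.

Definition munit i : mindex n := [ffun j => (j == i : nat)].

(** Pascal's rule in coordinate i. The test on [a i] guards against the truncated subtraction in
    [msub]. *)
Lemma diff_coeffS d r a i :
  diff_coeff (d + munit i) r a = diff_coeff d r a +
    (if (0 < a i)%N then - r i * diff_coeff d r (msub a (munit i)) else 0).
Proof.
rewrite /diff_coeff (bigD1 i) //= [in RHS](bigD1 i) //=.
rewrite [in X in _ = _ + X](bigD1 i) //= maddE !ffunE eqxx addn1.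
have -> : \prod_(j | j != i) ((- r j) ^+ a j *+ 'C((d + munit i)%R j, a j)) =
    \prod_(j | j != i) ((- r j) ^+ a j *+ 'C(d j, a j)).
  by apply: eq_bigr => j ji; rewrite maddE ffunE (negbTE ji) addn0.
have -> : \prod_(j | j != i)
      ((- r j) ^+ msub a (munit i) j *+ 'C(d j, msub a (munit i) j)) =
    \prod_(j | j != i) ((- r j) ^+ a j *+ 'C(d j, a j)).
  by apply: eq_bigr => j ji; rewrite !ffunE (negbTE ji) subn0.
case: (a i) => [|k] /=; first by rewrite !bin0 addr0.
by rewrite subn1 /= binS mulrnDr mulrDl mulrA exprS mulrnAr.
Qed.

Variable f : mindex n -> K.

(** Splits one factor 1 - r_i S_i off the product of differences applied to f. *)
Lemma sum_diff_coeffS d r m i eta : (forall j, d j + (j == i) <= m)%N ->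
  \sum_(a <- box n m) diff_coeff (d + munit i) r a * f (eta + a) =
  \sum_(a <- box n m) diff_coeff d r a * f (eta + a) -
  r i * \sum_(a <- box n m) diff_coeff d r a * f (eta + munit i + a).
Proof.
move=> dm; under eq_bigr do rewrite diff_coeffS mulrDl.
rewrite big_split /= -mulNr mulr_sumr; congr (_ + _).
pose g a := (if (0 < a i)%N then - r i * diff_coeff d r (msub a (munit i)) else 0)
  * f (eta + a).
have msubK b : msub (munit i + b) (munit i) = b.
  by apply/ffunP => j; rewrite ffunE maddE addKn.
(* Reindex by the cube translated by [munit i]; by the bound on d both lists contain the support of
   g. *)
transitivity (\sum_(a <- [seq munit i + b | b <- box n m]) g a); last first.
  rewrite big_map; apply: eq_bigr => b _.
  by rewrite /g maddE [munit i i]ffunE eqxx /= msubK addrA mulrA.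
apply: eq_sum_support; first exact: box_uniq.
  rewrite map_inj_uniq ?box_uniq // => b b' bb'.
  by rewrite -[b]msubK bb' msubK.
move=> a; rewrite /g; case: ifP => [ai|]; last by rewrite mul0r eqxx.
move=> ga; have {ga} ad : mle (msub a (munit i)) d.
  by apply: (@diff_coeff_neq0 _ r); apply: contraNneq ga => ->; rewrite mulr0 mul0r.
have ab : a = munit i + msub a (munit i).
  by apply/ffunP => j; rewrite maddE !ffunE subnKC //; case: eqP => // ->.
apply/andP; split.
  rewrite mem_box; apply/forallP => j; apply: leq_trans (dm j).
  by have := ad j; rewrite !ffunE leq_subLR addnC.
rewrite ab map_f // mem_box; apply/forallP => j.
by apply: leq_trans (ad j) (leq_trans (leq_addr _ _) (dm j)).
Qed.

End DifferenceCoefficients.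

(** * Nonnegativity of differences of bounded functions *)

Section DifferencePositivity.
Variables (R : realType) (n : nat) (f : mindex n -> R).
Hypothesis f_ge0 : forall a, 0 <= f a.
Variable M : R.
Hypothesis f_le : forall a, f a <= M.

Lemma ge0_of_damped_shift (g : mindex n -> R) (C r : R) i :
    0 <= r < 1 -> (forall a, `|g a| <= C) ->
    (forall a, r * g (a + munit i) <= g a) -> forall a, 0 <= g a.
Proof.
move=> /andP[r0 r1] gC gr a.
have it k : r ^+ k * g (a + munit i *+ k) <= g a.
  elim: k => [|k IH]; first by rewrite expr0 mul1r mulr0n addr0.
  apply: le_trans IH; rewrite exprSr -mulrA mulrSr addrA.
  by rewrite ler_wpM2l ?exprn_ge0.
have rk : (r ^+ k @[k --> \oo] --> 0)%classic by apply: cvg_expr; rewrite ger0_norm.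
(* Iteration bounds g a below by r^k g(a + k e_i) >= - r^k C, which tends to 0. *)
have lim : (- (r ^+ k * C) @[k --> \oo] --> - (0 * C))%classic.
  exact: cvgN (cvgM rk (cvg_cst C)).
rewrite mul0r oppr0 in lim.
have := @limr_le _ _ _ _ (g a) _ (cvgP _ lim).
rewrite (cvg_lim _ lim) //; apply; near=> k.
apply: le_trans (it k); rewrite -mulrN ler_wpM2l ?exprn_ge0 //.
by have /ler_normlP[] := gC (a + munit i *+ k); rewrite lerNl.
Unshelve. all: by end_near.
Qed.

(** For d <= m, the value at eta of prod_i (1 - r_i S_i)^(d_i) f. *)
Definition diff m (d : mindex n) (r : 'I_n -> R) (eta : mindex n) : R :=
  \sum_(a <- box n m) diff_coeff d r a * f (eta + a).

(** Induction on the total gap between d and c: if d_i < c_i, the claim for d + e_i yields the claim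
    for d. *)
Lemma diff_ge0_descend m (c : mindex n) (r : 'I_n -> R) :
    (forall i, c i <= m)%N -> (forall i, 0 <= r i < 1) ->
    (forall eta, 0 <= diff m c r eta) ->
  forall d, mle d c -> forall eta, 0 <= diff m d r eta.
Proof.
move=> cm r01 c0 d; have [k] := ubnP (\sum_i (c i - d i))%N.
elim: k d => // k IH d + dc.
have [/forallP eqdc _|] := boolP [forall i, d i == c i].
  by have -> : d = c by apply/ffunP => i; apply/eqP.
rewrite negb_forall => /existsP[i di] sumk.
have dci : (d i < c i)%N by rewrite ltn_neqAle di dc.
(* Boundedness follows from 0 <= f <= M; the one-step inequality is nonnegativity of the difference
   with exponent [d + munit i]. *)
apply: (@ge0_of_damped_shift (diff m d r)
  (\sum_(a <- box n m) `|diff_coeff d r a| * M) (r i) i).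
- exact: r01.
- move=> a; apply: le_trans (ler_norm_sum _ _ _) _; apply: ler_sum => b _.
  by rewrite normrM ler_wpM2l // ger0_norm.
- move=> a; rewrite -subr_ge0.
  have dm j : (d j + (j == i) <= m)%N.
    case: eqP => [->|_]; first by rewrite addn1 (leq_trans dci).
    by rewrite addn0 (leq_trans (dc j)).
  rewrite -(sum_diff_coeffS f r a dm).
  apply: IH.
    move: sumk; rewrite ltnS; apply: leq_trans.
    rewrite (bigD1 i) //= [in X in (_ < X)%N](bigD1 i) //= maddE ffunE eqxx.
    rewrite -addSn leq_add //; first by rewrite addn1 -(subnSK dci).
    by apply: leq_sum => j ji; rewrite maddE ffunE (negbTE ji) addn0.
  by move=> j; rewrite maddE ffunE; case: eqP => [->|_]; rewrite ?addn1 ?addn0.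
Qed.

(** The difference is a polynomial q in t; by continuity a negative value at 1 would persist at some
    t in (0,1). *)
Lemma diff_ge0_limit m (d : mindex n) eta :
    (forall t : R, 0 < t < 1 -> 0 <= diff m d (fun=> t) eta) ->
  0 <= diff m d (fun=> 1) eta.
Proof.
move=> d0.
pose q : {poly R} :=
  \sum_(a <- box n m) (\prod_i ((- 'X) ^+ a i *+ 'C(d i, a i))) * (f (eta + a))%:P.
have qE t : q.[t] = diff m d (fun=> t) eta.
  rewrite horner_sum; apply: eq_bigr => a _; rewrite hornerM hornerC horner_prod.
  congr (_ * _); apply: eq_bigr => i _.
  by rewrite hornerMn horner_exp hornerN hornerX.
rewrite -qE leNgt; apply/negP => q1.
have : (\forall t \near 1^'-, q.[t] < 0)%classic.
  have /cvg_at_left_filter qc := @derive.continuous_horner R q 1.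
  exact: (cvgr_lt _ qc).
move=> qlt; have [] := @filter_ex _ (1^'-)%classic _ (fun t => 0 < t < 1 /\ q.[t] < 0).
  near=> t; split; last by near: t.
  by apply/andP; split; near: t; [exact: nbhs_left_gt | exact: nbhs_left_lt].
move=> t [t01]; rewrite qE ltNge d0 //.
Unshelve. all: by end_near.
Qed.

Lemma diff_mix m (d : mindex n) (r : 'I_n -> R) eta : (forall i, d i <= m)%N ->
  diff m d r eta = \sum_(b <- box n m)
    (\prod_i ((1 - r i) ^+ (d i - b i) * r i ^+ b i *+ 'C(d i, b i))) *
    diff m b (fun=> 1) eta.
Proof.
move=> dm; rewrite /diff; under [LHS]eq_bigr do rewrite (diff_coeff_mix _ _ dm).
under [LHS]eq_bigr do rewrite mulr_suml.
rewrite exchange_big /=; apply: eq_bigr => b _; rewrite mulr_sumr.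
by apply: eq_bigr => a _; rewrite mulrA.
Qed.

Lemma diff_ge0_mix m (d : mindex n) (r : 'I_n -> R) eta :
    (forall i, d i <= m)%N -> (forall i, 0 <= r i <= 1) ->
    (forall b, mle b d -> 0 <= diff m b (fun=> 1) eta) ->
  0 <= diff m d r eta.
Proof.
move=> dm r01 d0; rewrite diff_mix //; apply: sumr_ge0 => b _.
have [/forallP bd|] := boolP [forall i, (b i <= d i)%N].
  apply: mulr_ge0; last exact: d0.
  apply: prodr_ge0 => i _; have /andP[r0 r1] := r01 i.
  by rewrite mulrn_wge0 // mulr_ge0 ?exprn_ge0 // subr_ge0.
(* If b is not below d, some binomial coefficient in the weight is 0. *)
rewrite negb_forall => /existsP[i dib]; have {dib} di : (d i < b i)%N by rewrite ltnNge.
by rewrite (bigD1 i) //= bin_small // mulr0n !mul0r.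
Qed.

End DifferencePositivity.

(** * Unconditional sums *)

Section UnconditionalSums.
Variables (K : numFieldType) (I : choiceType).

Lemma is_usum_unique (V : normedModType K) (f : I -> V) s t :
  is_usum f s -> is_usum f t -> s = t.
Proof.
move=> fs ft; apply/eqP; rewrite -subr_eq0 -normr_le0; apply/ler_addgt0Pr => e e0.
rewrite add0r; have e2 : 0 < e / 2 by rewrite divr_gt0.
have [A AP] := fs _ e2; have [B BP] := ft _ e2.
have /ltW As := AP _ (fsubsetUl A B); have /ltW Bt := BP _ (fsubsetUr A B).
set S := \sum_(_ <- _) _ in As Bt.
have -> : s - t = (S - t) - (S - s) by rewrite opprB [RHS]addrC addrA subrK.
by apply: le_trans (ler_normB _ _) _; rewrite [e]splitr lerD.
Qed.

Lemma usumE (V : normedModType K) (f : I -> V) s : is_usum f s -> usum f = s.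
Proof. by move=> fs; apply: xget_unique => // t /is_usum_unique; apply. Qed.

Lemma is_usum_finite (V : normedModType K) (f : I -> V) (r : seq I) :
  uniq r -> (forall a, f a != 0 -> a \in r) -> is_usum f (\sum_(a <- r) f a).
Proof.
move=> ur fr e e0; exists [fset a in r]%fset => B rB.
rewrite (@eq_sum_support _ _ f B r) ?subrr ?normr0 //.
move=> a /fr ar; rewrite ar andbT; apply: (fsubsetP rB).
by rewrite in_fset.
Qed.

Lemma is_usumB (V : normedModType K) (f g : I -> V) s t :
  is_usum f s -> is_usum g t -> is_usum (fun a => f a - g a) (s - t).
Proof.
move=> fs gt e e0; have e2 : 0 < e / 2 by rewrite divr_gt0.
have [A AP] := fs _ e2; have [B BP] := gt _ e2.
exists (A `|` B)%fset => C ABC; rewrite sumrB.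
have -> (x y : V) : x - y - (s - t) = (x - s) - (y - t).
  by rewrite !opprD !opprK addrACA.
apply: le_lt_trans (ler_normB _ _) _; rewrite [e]splitr ltrD //.
  by apply: AP; apply: fsubset_trans ABC; apply: fsubsetUl.
by apply: BP; apply: fsubset_trans ABC; apply: fsubsetUr.
Qed.

(** Off a finite set A beyond which partial sums lie within 1 of s, each term is a difference of two
    such sums, hence at most 2 in norm. *)
Lemma is_usum_bounded (V : normedModType K) (f : I -> V) s :
  is_usum f s -> exists M, forall a, `|f a| <= M.
Proof.
move=> fs; have [A AP] := fs 1 ltr01.
exists (\sum_(a <- A) `|f a| + 2) => a.
have [aA|aA] := boolP (a \in A).
  rewrite (big_fsetD1 a) //= -addrA lerDl addr_ge0 //; exact: sumr_ge0.
apply: ler_wpDl; first exact: sumr_ge0.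
have /ltW := AP _ (fsubsetUr [fset a]%fset A).
rewrite big_fsetU1 //=; have /ltW := AP _ (fsubset_refl A).
set S := \sum_(_ <- _) _ => As aAs.
have -> : f a = (f a + S - s) - (S - s) by rewrite opprB addrA subrK addrK.
by apply: le_trans (ler_normB _ _) _; rewrite lerD.
Qed.

End UnconditionalSums.

(** * Negative binomial series *)

Section NegativeBinomialSeries.
Variable K : numFieldType.
Implicit Types x z : K.

(** Truncation of the expansion of (1 - x)^(-d). For d = 0 the truncated subtraction leaves only the
    term j = 0, equal to 1. *)
Definition negbin_psum (d m : nat) x := \sum_(j < m.+1) x ^+ j *+ 'C(d + j - 1, j).

(** By Pascal's rule, multiplication by 1 - x lowers the exponent, up to one boundary term. This
    drives the inductions on d below. *)
Lemma negbin_psumS d m x :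
  (1 - x) * negbin_psum d.+1 m x = negbin_psum d m x - x ^+ m.+1 *+ 'C(d + m, m).
Proof.
elim: m => [|m IH].
  by rewrite /negbin_psum !big_ord_recl !big_ord0 !addr0 !expr0 !bin0 mulr1 expr1.
rewrite /negbin_psum big_ord_recr [in RHS]big_ord_recr /= -!/(negbin_psum _ _ _).
rewrite mulrDr IH addSn subn1 /= addnS subn1 /= binS.
move: 'C(_, _) 'C(_, _) => b c; rewrite [x ^+ m.+2]exprS !mulrnDr; ring.
Qed.

Lemma negbin_psum0 m x : negbin_psum 0 m x = 1.
Proof.
rewrite /negbin_psum big_ord_recl big1 ?addr0 ?bin0 // => j _.
by rewrite add0n bin_small ?mulr0n // lift0 subn1.
Qed.

Lemma negbin_psum_ge0 d m x : 0 <= x -> 0 <= negbin_psum d m x.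
Proof. by move=> x0; apply: sumr_ge0 => j _; rewrite mulrn_wge0 // exprn_ge0. Qed.

Lemma negbin_psum_le d m x : 0 <= x < 1 -> negbin_psum d m x <= (1 - x) ^- d.
Proof.
move=> /andP[x0 x1]; have y0 : 0 < 1 - x by rewrite subr_gt0.
elim: d => [|d IH]; first by rewrite negbin_psum0 expr0 invr1.
rewrite -(ler_pM2l y0) negbin_psumS [(1 - x) ^+ _]exprS invfM mulVKf ?gt_eqF //.
by apply: le_trans IH; rewrite lerBlDr lerDl mulrn_wge0 // exprn_ge0.
Qed.

(* The remainder at z is a power series with nonnegative coefficients, hence bounded by
   the remainder at |z|. *)
Lemma negbin_psum_dist d m z : `|z| < 1 ->
  `|(1 - z) ^- d - negbin_psum d m z| <= (1 - `|z|) ^- d - negbin_psum d m `|z|.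
Proof.
move=> z1; have y0 : 0 < 1 - `|z| by rewrite subr_gt0.
have yz : 1 - `|z| <= `|1 - z|.
  by apply: le_trans (lerB_dist _ _); rewrite normr1.
have z0 : 0 < `|1 - z| by apply: lt_le_trans yz.
elim: d => [|d IH]; first by rewrite !negbin_psum0 !expr0 invr1 !subrr normr0.
set c := 'C(d + m, m).
(* Recursion for the remainder, used both at z and at |z|. *)
have step x : 1 - x != 0 -> (1 - x) ^- d.+1 - negbin_psum d.+1 m x =
    ((1 - x) ^- d - negbin_psum d m x + x ^+ m.+1 *+ c) / (1 - x).
  move=> x1; apply: (mulfI x1).
  rewrite mulrBr negbin_psumS [(1 - x) ^+ _]exprS invfM mulVKf //.
  by rewrite mulrC mulfVK // opprB addrA addrAC.
have nz0 : 1 - z != 0 by rewrite -normr_gt0.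
have ny0 : 1 - `|z| != 0 by rewrite gt_eqF.
rewrite (step _ nz0) (step _ ny0) normrM normfV.
apply: ler_pM => //; last by rewrite lef_pV2.
apply: le_trans (ler_normD _ _) _.
by rewrite normrMn normrX lerD.
Qed.

(** Telescoping: u v - u' v' = (u - u') v + u' (v - v'), with each factor dominated by its
    majorant. *)
Lemma ler_dist_prod (I : Type) (s : seq I) (A B : I -> K) (a b : I -> K) :
    (forall i, `|A i - B i| <= a i - b i) -> (forall i, `|B i| <= b i) ->
  `|\prod_(i <- s) A i - \prod_(i <- s) B i| <= \prod_(i <- s) a i - \prod_(i <- s) b i.
Proof.
move=> AB Bb; have Aa i : `|A i| <= a i.
  rewrite -[A i](subrK (B i)); apply: le_trans (ler_normD _ _) _.
  by rewrite -[a i](subrK (b i)) lerD.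
elim: s => [|i s IH]; first by rewrite !big_nil !subrr normr0.
have PB : `|\prod_(j <- s) A j| <= \prod_(j <- s) a j.
  by rewrite normr_prod; apply: ler_prod => j _; rewrite normr_ge0 Aa.
rewrite !big_cons.
have -> (u v u' v' : K) : u * v - u' * v' = (u - u') * v + u' * (v - v') by ring.
have -> : a i * \prod_(j <- s) a j - b i * \prod_(j <- s) b j =
  (a i - b i) * \prod_(j <- s) a j + b i * (\prod_(j <- s) a j - \prod_(j <- s) b j)
  by ring.
apply: le_trans (ler_normD _ _) _; rewrite !normrM.
by rewrite lerD // ler_pM.
Qed.

Lemma sum_subset (I : eqType) (V : nmodType) (f : I -> V) (s t : seq I) :
    uniq s -> uniq t -> {subset s <= t} ->
  \sum_(a <- t) f a = \sum_(a <- s) f a + \sum_(a <- t | a \notin s) f a.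
Proof.
move=> us ut st; rewrite (bigID (mem s)) /=; congr (_ + _).
rewrite -big_filter; apply: perm_big; apply: uniq_perm; rewrite ?filter_uniq // => a.
by rewrite mem_filter andb_idr //; apply: st.
Qed.

Variable n : nat.
Implicit Types (d a : mindex n).

Definition negbin_term d (z : 'I_n -> K) a : K :=
  \prod_i (z i ^+ a i *+ 'C(d i + a i - 1, a i)).

Lemma norm_negbin_term d (z : 'I_n -> K) a :
  `|negbin_term d z a| = negbin_term d (fun i => `|z i|) a.
Proof. by rewrite normr_prod; apply: eq_bigr => i _; rewrite normrMn normrX. Qed.

Lemma sum_negbin_term d (z : 'I_n -> K) m :
  \sum_(a <- box n m) negbin_term d z a = \prod_i negbin_psum (d i) m (z i).
Proof. exact: sum_box_prod (fun i j => z i ^+ j *+ 'C(d i + j - 1, j)) m. Qed.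

(** The terms are nonnegative, so the list may be enlarged to a cube, over which the sum factors. *)
Lemma sum_negbin_term_le d (x : 'I_n -> K) (s : seq (mindex n)) :
    (forall i, 0 <= x i < 1) -> uniq s ->
  \sum_(a <- s) negbin_term d x a <= \prod_i (1 - x i) ^- d i.
Proof.
move=> x01 us; have [m sm] := subset_box s.
have t0 a : 0 <= negbin_term d x a.
  apply: prodr_ge0 => i _; rewrite mulrn_wge0 // exprn_ge0 //.
  by case/andP: (x01 i).
apply: le_trans (_ : \sum_(a <- box n m) negbin_term d x a <= _).
  by rewrite (sum_subset _ us (box_uniq n m) sm) lerDl sumr_ge0.
rewrite sum_negbin_term; apply: ler_prod => i _.
by rewrite negbin_psum_le // negbin_psum_ge0 //; case/andP: (x01 i).
Qed.

End NegativeBinomialSeries.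

Section DifferenceSums.
Variables (K : comNzRingType) (n : nat).
Implicit Types (a d : mindex n).

Lemma sum_diff_coeff m d (r z : 'I_n -> K) : (forall i, d i <= m)%N ->
  \sum_(a <- box n m) diff_coeff d r a * mpow z a = \prod_i (1 - r i * z i) ^+ d i.
Proof.
move=> dm; transitivity (\sum_(a <- box n m)
    \prod_i ((- r i) ^+ a i *+ 'C(d i, a i) * z i ^+ a i)).
  by apply: eq_bigr => a _; rewrite big_split.
rewrite (sum_box_prod (fun i j => ((- r i) ^+ j *+ 'C(d i, j)) * z i ^+ j)).
apply: eq_bigr => i _; rewrite exprDn.
under [RHS]eq_bigr do rewrite expr1n mul1r -mulNr exprMn -mulrnAl.
rewrite (@big_ord_widen _ _ _ (d i).+1 m.+1
  (fun j => ((- r i) ^+ j *+ 'C(d i, j)) * z i ^+ j)); last exact: dm.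
rewrite [RHS]big_mkcond /=; apply: eq_bigr => j _; case: ifP => // /negbT.
by rewrite -leqNgt => dj; rewrite bin_small // mulr0n mul0r.
Qed.

Lemma diff_coeff_box d m (r : 'I_n -> K) a : (forall i, d i <= m)%N ->
  diff_coeff d r a != 0 -> a \in box n m.
Proof.
move=> dm /diff_coeff_neq0 ad; rewrite mem_box; apply/forallP => i.
exact: leq_trans (ad i) (dm i).
Qed.

Lemma mindex_bound d : exists m, forall i, (d i <= m)%N.
Proof. by exists (\max_i d i)%N => i; apply: leq_bigmax. Qed.

End DifferenceSums.

(** * The kernel of the weights and its reciprocal *)

Section NegativeBinomialLimit.
Variable R : realType.

(** Induction on d. The boundary term is x u_m, with u the terms of the series for d+1; that series
    has bounded increasing partial sums, so u_m tends to 0. *)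
Lemma cvg_negbin_psum d (x : R) : 0 <= x < 1 ->
  (negbin_psum d m x @[m --> \oo] --> (1 - x) ^- d)%classic.
Proof.
move=> x01; have /andP[x0 x1] := x01; have y0 : 0 < 1 - x by rewrite subr_gt0.
elim: d => [|d IH].
  rewrite expr0 invr1; under eq_fun do rewrite negbin_psum0; exact: cvg_cst.
pose u (j : nat) := x ^+ j *+ 'C(d.+1 + j - 1, j).
have uE m : negbin_psum d.+1 m x = series u m.+1 by rewrite /series /= big_mkord.
have /cvg_series_cvg_0 u0 : cvgn (series u).
  apply: nondecreasing_is_cvgn.
    apply/nondecreasing_seqP => m; rewrite /series /= big_nat_recr //= lerDl.
    by rewrite mulrn_wge0 // exprn_ge0.
  exists ((1 - x) ^- d.+1) => _ [m _ <-].
  apply: le_trans (negbin_psum_le d.+1 m x01); rewrite uE /series /=.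
  by rewrite [leRHS]big_nat_recr //= lerDl mulrn_wge0 // exprn_ge0.
have -> : (fun m => negbin_psum d.+1 m x) =
    (fun m => (negbin_psum d m x - x * u m) * (1 - x)^-1).
  apply/funext => m; rewrite /u addSn subn1 /= mulrnAr -exprS -negbin_psumS.
  by rewrite mulrC mulKf // gt_eqF.
have -> : (1 - x) ^- d.+1 = ((1 - x) ^- d - x * 0) * (1 - x)^-1.
  by rewrite mulr0 subr0 exprSr invfM mulrC.
by apply: cvgM; [apply: cvgB => //; apply: cvgM | ]; first exact: cvg_cst; last exact: cvg_cst.
Qed.

Variable n : nat.
Implicit Types (d : mindex n) (z : 'I_n -> R[i]).

Lemma normc_lt1 (z : R[i]) : `|z| < 1 ->
  exists2 x : R, 0 <= x < 1 & `|z| = x%:C%C.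
Proof.
move=> z1; exists (complex.Re `|z|); last by rewrite RRe_real // normr_real.
by rewrite -ler0c -ltcR RRe_real ?normr_real ?normr_ge0.
Qed.

Lemma negbin_psum_real k m (x : R) :
  negbin_psum k m (x%:C%C) = (negbin_psum k m x)%:C%C.
Proof.
by rewrite rmorph_sum; apply: eq_bigr => j _; rewrite rmorphMn rmorphXn.
Qed.

Lemma prod_negbin_psum_approx d z (e : R[i]) : polydisc z -> 0 < e ->
  exists m, \prod_i (1 - `|z i|) ^- d i - \prod_i negbin_psum (d i) m `|z i| < e.
Proof.
move=> z1 e0; have eR : e = (complex.Re e)%:C%C by rewrite RRe_real // gtr0_real.
have e0' : 0 < complex.Re e by rewrite -ltcR -eR.
have /choice[x xP] i : exists x : R, (0 <= x < 1) /\ `|z i| = x%:C%C.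
  by have [x ? ?] := normc_lt1 (z1 i); exists x.
have lim : (\prod_i negbin_psum (d i) m (x i) @[m --> \oo] -->
    \prod_i (1 - x i) ^- d i)%classic.
  apply: cvg_big => [|i _]; first exact: mul_continuous.
  by apply: cvg_negbin_psum; case: (xP i).
have /cvgrPdist_lt/(_ _ e0')[m _ /(_ m (leqnn m)) /= mP] := lim.
exists m; rewrite eR.
have -> : \prod_i (1 - `|z i|) ^- d i = (\prod_i (1 - x i) ^- d i)%:C%C.
  rewrite rmorph_prod; apply: eq_bigr => i _; have [_ ->] := xP i.
  by rewrite fmorphV rmorphXn rmorphB.
have -> : \prod_i negbin_psum (d i) m `|z i| =
    (\prod_i negbin_psum (d i) m (x i))%:C%C.
  rewrite rmorph_prod; apply: eq_bigr => i _; have [_ ->] := xP i.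
  exact: negbin_psum_real.
rewrite -rmorphB ltcR; exact: le_lt_trans (ler_norm _) mP.
Qed.

Lemma is_usum_negbin_term d z : polydisc z ->
  is_usum (negbin_term d z : _ -> R[i]^o) (\prod_i (1 - z i) ^- d i).
Proof.
move=> z1 e e0; have e2 : 0 < e / 2 by rewrite divr_gt0.
have [m mP] := prod_negbin_psum_approx d z1 e2.
exists [fset a in box n m]%fset => B mB.
have bB : {subset box n m <= B}.
  by move=> a am; apply: (fsubsetP mB); rewrite in_fset.
have x01 i : 0 <= `|z i| < 1 by rewrite normr_ge0 z1.
(* The error splits into the terms outside the cube and the error of the product over the cube. Both
   are at most the error of that product at |z|. *)
have tail : `|\sum_(a <- B | a \notin box n m) negbin_term d z a| <= 
    \prod_i (1 - `|z i|) ^- d i - \prod_i negbin_psum (d i) m `|z i|.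
  apply: le_trans (ler_norm_sum _ _ _) _.
  rewrite -sum_negbin_term lerBrDl.
  under [X in _ + X <= _]eq_bigr do rewrite norm_negbin_term.
  rewrite -(sum_subset _ (box_uniq n m) (fset_uniq B) bB).
  exact: (sum_negbin_term_le d x01 (fset_uniq B)).
rewrite (sum_subset _ (box_uniq n m) (fset_uniq B) bB) sum_negbin_term addrAC.
apply: le_lt_trans (ler_normD _ _) _; rewrite [e]splitr ltrD //; last exact: le_lt_trans mP.
apply: le_lt_trans mP; rewrite distrC; apply: ler_dist_prod => i.
  exact: negbin_psum_dist.
apply: le_trans (ler_norm_sum _ _ _) _; apply: ler_sum => j _.
by rewrite normrMn normrX.
Qed.

Lemma wkernel_weight d z : polydisc z ->
  wkernel (weight R d) z = \prod_i (1 - z i) ^- d i.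
Proof.
move=> z1; rewrite /wkernel; have -> : (fun a : mindex n =>
    (mpow z a / (\prod_i weight R d i (a i))%:C%C : R[i]^o)) = negbin_term d z.
  apply/funext => a; rewrite /mpow rmorph_prod /= -prodf_div.
  apply: eq_bigr => i _.
  by rewrite /weight fmorphV rmorph_nat invrK mulr_natr.
exact: usumE (is_usum_negbin_term d z1).
Qed.

Lemma reciprocal_coeff_weight_spec d :
  is_reciprocal_coeff (weight R d) (diff_coeff d (fun=> 1)).
Proof.
move=> z z1; rewrite wkernel_weight //.
have nz i : 1 - z i != 0.
  apply: contraTneq (z1 i) => /subr0_eq <-; by rewrite normr1 ltxx.
split; first by apply/prodf_neq0 => i _; rewrite invr_eq0 expf_eq0 negb_and nz orbT.
rewrite -prodfV; under [X in is_usum _ X]eq_bigr do rewrite invrK.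
have [m dm] := mindex_bound d.
have -> : \prod_i (1 - z i) ^+ d i =
    \sum_(a <- box n m) diff_coeff d (fun=> 1) a * mpow z a.
  by rewrite sum_diff_coeff //; apply: eq_bigr => i _; rewrite mul1r.
apply: is_usum_finite; first exact: box_uniq.
move=> a; rewrite mulf_eq0 negb_or => /andP[a0 _].
exact: diff_coeff_box a0.
Qed.
End NegativeBinomialLimit.

(** * Uniqueness of power series coefficients *)

Lemma digits_lt n L (a : 'I_n -> nat) : (forall i, a i < L)%N ->
  (\sum_i a i * L ^ i < L ^ n)%N.
Proof.
elim: n a => [|n IH] a aL; first by rewrite big_ord0.
rewrite big_ord_recl expn0 muln1.
under eq_bigr do rewrite lift0 expnS mulnCA.
rewrite -big_distrr /= expnS.
apply: (@leq_trans (L * (\sum_(i < n) a (lift ord0 i) * L ^ i).+1)).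
  by rewrite mulnS ltn_add2r.
by rewrite leq_mul2l IH ?orbT.
Qed.

Lemma digits_inj n L (a b : 'I_n -> nat) :
    (forall i, a i < L)%N -> (forall i, b i < L)%N ->
  (\sum_i a i * L ^ i = \sum_i b i * L ^ i)%N -> a =1 b.
Proof.
elim: n a b => [|n IH] a b aL bL; first by move=> _ [].
have E (c : 'I_n.+1 -> nat) :
    (\sum_i c i * L ^ i = (\sum_(i < n) c (lift ord0 i) * L ^ i) * L + c ord0)%N.
  rewrite big_ord_recl expn0 muln1 addnC big_distrl; congr (_ + _)%N.
  by apply: eq_bigr => i _; rewrite lift0 expnSr mulnA.
rewrite !E => ab; have ab0 : a ord0 = b ord0.
  by have := congr1 (modn^~ L) ab; rewrite !modnMDl !modn_small.
have L0 : (0 < L)%N by apply: leq_ltn_trans (aL ord0).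
move: ab; rewrite ab0 => /addIn/eqP; rewrite eqn_pmul2r // => /eqP abr.
have {}IH := IH (fun i => a (lift ord0 i)) (fun i => b (lift ord0 i))
  (fun i => aL _) (fun i => bL _) abr.
by move=> i; case: (unliftP ord0 i) => [j ->|->]; [exact: IH | exact: ab0].
Qed.

(** Provides a strict minimizer of a positive linear weight among the indices satisfying P, so that
    a power series has a single term of lowest order along a suitable curve. *)
Lemma separating_weights n (P : mindex n -> Prop) (b : mindex n) : P b ->
  exists (w : 'I_n -> nat) (c : mindex n), [/\ forall i, (0 < w i)%N, P c &
    forall a, P a -> a <> c -> (\sum_i c i * w i < \sum_i a i * w i)%N].
Proof.
move=> Pb; set L := (\sum_i b i).+1.
have L0 : (0 < L)%N by [].
(* These weights compare first the total degrees and then, within a degree smaller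
   than L, the base-L numbers whose digits are the entries. *)
exists (fun i : 'I_n => L ^ n + L ^ i)%N.
have wE (a : mindex n) : (\sum_i a i * (L ^ n + L ^ i) =
    (\sum_i a i) * L ^ n + \sum_i a i * L ^ i)%N.
  by rewrite big_distrl -big_split; apply: eq_bigr => i _; rewrite mulnDr.
set f := fun a : mindex n => (\sum_i a i * (L ^ n + L ^ i))%N.
have digit (a : mindex n) i : (\sum_i a i < L -> a i < L)%N.
  by apply: leq_ltn_trans; rewrite (bigD1 i) //= leq_addr.
(* An index of degree at least L = deg b + 1 weighs at least L * L^n, more than b, whose digit part
   is below L^n. *)
have small (a : mindex n) : (f a <= f b -> \sum_i a i < L)%N.
  rewrite /f !wE => ab; rewrite ltnS leqNgt; apply/negP => ba.
  have := leq_trans (leq_trans (leq_addr _ _) ab)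
    (_ : _ <= (\sum_i b i) * L ^ n + (L ^ n).-1)%N.
  rewrite leq_add2l -ltnS prednK ?expn_gt0 ?L0 //.
  move=> /(_ (digits_lt (fun i => digit b i (leqnn _)))).
  apply/negP; rewrite -ltnNge.
  apply: (@leq_trans ((\sum_i b i).+1 * L ^ n)); last by rewrite leq_mul2r ba orbT.
  by rewrite mulSn addnC ltn_add2r prednK ?expn_gt0 ?L0.
have ex : exists k, `[< exists2 a, P a & f a = k >].
  by exists (f b); apply/asboolP; exists b.
case: (ex_minnP ex) => k /asboolP[c Pc fc] kmin.
have cmin a : P a -> (f c <= f a)%N.
  by move=> Pa; rewrite fc; apply: kmin; apply/asboolP; exists a.
exists c; split => // [i|a Pa ac]; first by rewrite addn_gt0 expn_gt0 L0.
rewrite ltn_neqAle [X in _ && X]cmin // andbT; apply/eqP => ca; apply: ac.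
have cL := small c (cmin _ Pb).
have aL : (\sum_i a i < L)%N by apply: small; rewrite /f -ca; apply: cmin.
have dc := digits_lt (fun i => digit c i cL).
have da := digits_lt (fun i => digit a i aL).
move: ca; rewrite !wE => ca.
(* Division by L^n recovers the total degree; the remainders then determine the digits. *)
have ca1 : (\sum_i c i = \sum_i a i)%N.
  have := congr1 (divn^~ (L ^ n)%N) ca.
  by rewrite !divnMDl ?expn_gt0 ?L0 // !divn_small // !addn0.
apply/ffunP; apply: (@digits_inj _ L) => [i|i|]; [exact: digit|exact: digit|].
by apply/esym/eqP; rewrite -(eqn_add2l ((\sum_i a i) * L ^ n)) -{1}ca1 ca.
Qed.

Section PowerSeriesUniqueness.
Variables (K : numFieldType) (n : nat) (d : mindex n -> K).
Hypothesis d_zero : forall z : 'I_n -> K, (forall i, `|z i| < 1) ->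
  is_usum (fun a => d a * mpow z a : K^o) 0.

Lemma le_small_eq0 (x c : K) :
  0 <= x -> 0 <= c -> (forall w, 0 < w <= 1 -> x <= c * w) -> x = 0.
Proof.
move=> x0 c0 h; apply/eqP/negPn/negP => nx; have {nx} x_gt0 : 0 < x by rewrite lt_def nx.
have cx : 0 < c + x by rewrite ltr_wpDl.
have : x <= c * (x / (c + x)).
  (* At w = x / (c + x) the bound would read c + x <= c. *)
  by apply: h; rewrite divr_gt0 //= ler_pdivrMr // mul1r lerDr.
rewrite mulrCA ler_pMr // ler_pdivlMr // mul1r gerDl => x_le0.
by have := lt_le_trans x_gt0 x_le0; rewrite ltxx.
Qed.

(* Along z_i = t^(w i) with separating weights w, the term of lowest weight dominates
   the sum of all the others as t tends to 0. *)
Lemma power_series_eq0 a : d a = 0.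
Proof.
apply/eqP/negPn/negP => /(@separating_weights _ (fun a => d a != 0)).
move=> [w [b [w0 db bmin]]].
pose f (c : mindex n) := (\sum_i c i * w i)%N.
have powE (t : K) c : mpow (fun i => t ^+ w i) c = t ^+ f c.
  rewrite /mpow /f expr_sum; apply: eq_bigr => i _.
  by rewrite -exprM mulnC.
have t1 (t : K) : 0 <= t < 1 -> forall i, `|t ^+ w i| < 1.
  by move=> /andP[tge0 tlt1] i; rewrite ger0_norm ?exprn_ge0 // exprn_ilt1 // -lt0n.
have h01 : 0 <= (2^-1 : K) < 1 by rewrite invr_ge0 ler0n invf_lt1 ?ltr0n // ltr1n.
have [M MP] := is_usum_bounded (d_zero (t1 _ h01)).
have M0 : 0 <= M by apply: le_trans (MP 0).
(* C is the sum of all 2^(- f c), a product of geometric series, that is, negative binomial series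
   of exponent 1. *)
pose C := \prod_i (1 - (2^-1 : K) ^+ w i) ^- 1.
have CP (s : seq (mindex n)) : uniq s -> \sum_(c <- s) (2^-1 : K) ^+ f c <= C.
  move=> us; have := @sum_negbin_term_le K n [ffun=> 1%N] (fun i => 2^-1 ^+ w i) s.
  rewrite /C; under [X in _ -> _ -> _ <= X]eq_bigr do rewrite ffunE.
  under [X in _ -> _ -> X <= _]eq_bigr => c _.
    rewrite (_ : negbin_term _ _ c = 2^-1 ^+ f c); last first.
      rewrite -powE; apply: eq_bigr => i _.
      by rewrite ffunE addnC addnK binn mulr1n.
    over.
  apply => // i; have /andP[h0 _] := h01; rewrite exprn_ge0 //=.
  by have := t1 _ h01 i; rewrite ger0_norm // exprn_ge0.
have C0 : 0 <= C by apply: le_trans (CP [::] isT); rewrite big_nil.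
(* Take t = x/4, so t^(f c) = 2^(- f c) 2^(- f c) x^(f c). One factor 2^(- f c) is absorbed in the
   bound M at t = 1/2, the other is summed by C, and x^(f c) <= x^(f b + 1) for every other nonzero
   term. *)
have key x : 0 < x <= 1 -> `|d b| <= 4 ^+ f b * (M * C) * x.
  move=> /andP[x0 x1].
  have x4 : 0 <= x / 4 < 1.
    rewrite divr_ge0 ?ler0n ?(ltW x0) //= ltr_pdivrMr ?ltr0n // mul1r.
    by apply: le_lt_trans x1 _; rewrite ltr1n.
  suff : `|d b| * (x / 4) ^+ f b <= M * C * x ^+ (f b).+1.
    rewrite exprMn exprVn [ `|d b| * _]mulrA ler_pdivrMr ?exprn_gt0 ?ltr0n // => h.
    rewrite -(ler_pM2r (exprn_gt0 (f b) x0)).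
    by apply: le_trans h _; rewrite exprS le_eqVlt; apply/orP; left; apply/eqP; ring.
  apply/ler_addgt0Pr => e e0.
  have [A AP] := d_zero (t1 _ x4) e0.
  have /ltW := AP _ (fsubsetUr [fset b]%fset A).
  rewrite subr0 (big_fsetD1 b) /= ?in_fset1U ?eqxx // powE.
  set B := (_ `\ b)%fset => le_e.
  rewrite -[X in X <= _](_ : `|d b * (x / 4) ^+ f b| = _); last first.
    by rewrite normrM [X in _ * X]ger0_norm // exprn_ge0 //; case/andP: x4.
  rewrite -[d b * _](addrK (\sum_(c <- B) d c * mpow (fun i => (x / 4) ^+ w i) c)).
  apply: le_trans (ler_normB _ _) _; rewrite addrC lerD //.
  apply: le_trans (ler_norm_sum _ _ _) _.
  apply: le_trans (_ : \sum_(c <- B) M * (2^-1 ^+ f c) * x ^+ (f b).+1 <= _).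
    rewrite big_seq [leRHS]big_seq; apply: ler_sum => c cB.
    rewrite powE normrM; have [->|dc] := eqVneq (d c) 0.
      by rewrite normr0 mul0r !mulr_ge0 ?exprn_ge0 ?invr_ge0 ?(ltW x0).
    have bc : (f b < f c)%N.
      by apply: bmin => // cb; move: cB; rewrite cb in_fsetD1 eqxx.
    have -> : `|(x / 4) ^+ f c| = 2^-1 ^+ f c * (2^-1 ^+ f c * x ^+ f c).
      rewrite ger0_norm ?exprn_ge0 //; last by case/andP: x4.
      by rewrite -!exprMn; congr (_ ^+ _); field.
    rewrite [leLHS]mulrA -[leRHS]mulrA ler_pM ?mulr_ge0 ?exprn_ge0 ?invr_ge0 ?(ltW x0) //.
      have := MP c; rewrite powE normrM [X in _ * X]ger0_norm //.
    by rewrite ler_wpM2l ?exprn_ge0 ?invr_ge0 // ler_wiXn2l ?(ltW x0).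
  rewrite -mulr_suml -mulr_sumr ler_wpM2r ?exprn_ge0 ?(ltW x0) // ler_wpM2l //.
  exact: CP (fset_uniq B).
move: db; rewrite -normr_eq0 => /eqP; apply.
apply: le_small_eq0 key => //.
by rewrite mulr_ge0 ?exprn_ge0 ?mulr_ge0.
Qed.
End PowerSeriesUniqueness.

(** * Positivity of the defect operators *)

Section MainTheorem.
Variables (R : realType) (n : nat).
Implicit Types (a b d : mindex n).

(** Two coefficient families of the reciprocal differ by a power series summing to 0 on the
    polydisc, so the chosen family is the polynomial one. *)
Lemma reciprocal_coeff_weight d :
  reciprocal_coeff (weight R d) = diff_coeff d (fun=> 1).
Proof.
apply: xget_unique => [|c cP]; first exact: reciprocal_coeff_weight_spec.
apply/funext => a; apply/eqP; rewrite -subr_eq0; apply/eqP.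
apply: (@power_series_eq0 _ _ (fun a => c a - diff_coeff d (fun=> 1) a)) => z z1.
have [_ cz] := cP z z1; have [_ dz] := reciprocal_coeff_weight_spec d z1.
rewrite -[X in is_usum _ X](subrr (wkernel (weight R d) z)^-1).
rewrite (_ : (fun a => _) = fun a =>
    (c a * mpow z a : R[i]^o) - diff_coeff d (fun=> 1) a * mpow z a).
  exact: is_usumB.
by apply/funext => b; rewrite mulrBl.
Qed.

(** The constant sequence 1 is the weight of exponent 1, as C(l,l) = 1, so every choice is the
    weight of an exponent below d. *)
Lemma weight_choiceP d (W : 'I_n -> nat -> R) : (forall i, 1 <= d i)%N ->
  weight_choices (weight R d) W -> exists2 c, mle c d & W = weight R c.
Proof.
move=> d1 dW; exists [ffun i => if `[< W i = weight R d i >] then d i else 1%N].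
  by move=> i; rewrite ffunE; case: ifP.
apply/funext => i; rewrite /weight ffunE; case: asboolP => // Wi.
case: (dW i) => // ->; apply/funext => l.
by rewrite addnC addnK binn invr1.
Qed.

Lemma defect_coeffE a b : mle a b ->
  (-1) ^+ mabs a * ((mfact b)%:R / (mfact a * mfact (msub b a))%:R) =
  (diff_coeff b (fun=> 1) a : R)%:C%C :> R[i].
Proof.
move=> ab; have -> : mfact b = ((\prod_i 'C(b i, a i)) * (mfact a * mfact (msub b a)))%N.
  rewrite /mfact -!big_split; apply: eq_bigr => i _.
  by rewrite ffunE /= bin_fact.
rewrite natrM mulfK; last first.
  rewrite pnatr_eq0 -lt0n muln_gt0.
  by apply/andP; split; apply: prodn_gt0 => i; apply: fact_gt0.
rewrite /mabs expr_sum natr_prod -big_split rmorph_prod; apply: eq_bigr => i _.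
by rewrite /= rmorphMn rmorphXn rmorphN1 -[RHS]mulr_natr.
Qed.

Variable H : completeNormedModType R[i].
Variable dot : {dot H for Num.conj}.
Hypothesis dot_norm : forall x : H, dot x x = `|x| ^+ 2.
Variable T : 'I_n -> {linear H -> H}.
Hypothesis T_contraction : forall i, contractive_op (T i).
Hypothesis T_comm : forall i j (x : H), T i (T j x) = T j (T i x).

Lemma dot_sum_opow_adj (s : seq (mindex n)) (c : mindex n -> R) x :
  dot (\sum_(a <- s) (c a)%:C%C *: opow_adj dot T a x) x =
  (\sum_(a <- s) c a * adj_norm2 dot T x a)%:C%C.
Proof.
rewrite linear_sumlz rmorph_sum; apply: eq_bigr => a _.
by rewrite linearZl_LR /= dot_opow_adj // rmorphM.
Qed.

Lemma defect_positive b m : (forall i, b i <= m)%N ->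
  positive_op dot (defect dot T b) <->
  forall x, 0 <= diff (adj_norm2 dot T x) m b (fun=> 1) 0.
Proof.
move=> bm; suff E x : dot (defect dot T b x) x =
    (diff (adj_norm2 dot T x) m b (fun=> 1) 0)%:C%C.
  by split => + x => /(_ x); rewrite E ler0c.
rewrite /diff; under eq_bigr do rewrite add0r.
rewrite -dot_sum_opow_adj; congr (dot _ x); rewrite /defect.
under eq_fsbigr => a /set_mem ab do rewrite defect_coeffE //.
(* The sum over a <= b extends to the cube by zero coefficients. *)
apply: fsbig_fwiden; last 1 first.
- move=> a [/= _ ab]; rewrite (_ : diff_coeff b _ a = 0) ?scale0r //.
  by apply/eqP; apply: contra_notT ab; apply: diff_coeff_neq0.
- move=> a /= ab; rewrite mem_box; apply/forallP => i.
  exact: leq_trans (ab i) (bm i).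
- exact: box_uniq.
Qed.

Lemma weighted_defect_positive d m (r : 'I_n -> R) : (forall i, d i <= m)%N ->
  positive_op dot (weighted_defect dot T (weight R d) r) <->
  forall x, 0 <= diff (adj_norm2 dot T x) m d r 0.
Proof.
move=> dm; suff E x : dot (weighted_defect dot T (weight R d) r x) x =
    (diff (adj_norm2 dot T x) m d r 0)%:C%C.
  by split => + x => /(_ x); rewrite E ler0c.
rewrite /diff; under eq_bigr do rewrite add0r.
rewrite -dot_sum_opow_adj; congr (dot _ x).
(* The factor r^a turns the coefficients of prod_i (1 - z_i)^(d_i) into those of prod_i (1 - r_i
   z_i)^(d_i). *)
have cE a : diff_coeff d (fun=> 1) a * (mpow r a)%:C%C = (diff_coeff d r a)%:C%C :> R[i].
  rewrite /mpow !rmorph_prod /= -big_split /=; apply: eq_bigr => i _.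
  by rewrite rmorphMn /= !rmorphXn rmorphN /= mulrnAl -exprMn mulN1r.
rewrite /weighted_defect reciprocal_coeff_weight; apply: usumE.
under eq_fun do rewrite cE.
apply: is_usum_finite; first exact: box_uniq.
move=> a; apply: contraNT => am; rewrite (_ : diff_coeff d r a = 0) ?scale0r //.
by apply/eqP; apply: contraNT am; apply: diff_coeff_box.
Qed.

(** Turns nonnegativity at 0 for every vector into nonnegativity at every eta, as the descent
    requires. *)
Lemma diff_shift m d (r : 'I_n -> R) x eta :
  diff (adj_norm2 dot T x) m d r eta =
  diff (adj_norm2 dot T (opow (fun i => adjoint dot (T i)) eta x)) m d r 0.
Proof.
by apply: eq_bigr => a _; rewrite add0r adj_norm2D.
Qed.

Lemma contractive_iff_hypercontractive (gamma : mindex n) :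
    (forall i, 1 <= gamma i)%N ->
  contractive_multioperator dot T gamma <-> hypercontraction dot T (weight R gamma).
Proof.
move=> gamma1; have [m gm] := mindex_bound gamma.
have dm d : mle d gamma -> forall i, (d i <= m)%N.
  by move=> dg i; apply: leq_trans (dg i) (gm i).
have f0 x := @adj_norm2_ge0 R H dot n T x.
have fM x := adj_norm2_bound dot_norm T_contraction x.
split => [contr W|hyper d dg].
  move=> /(weight_choiceP gamma1)[d dg ->] r r01.
  apply/(weighted_defect_positive _ (dm d dg)) => x.
  apply: diff_ge0_mix (dm d dg) _ _ => [i|b bd].
    by have /andP[/ltW -> /ltW ->] := r01 i.
  have bg : mle b gamma by move=> i; apply: leq_trans (bd i) (dg i).
  exact: (defect_positive (dm b bg)).1 (contr b bg) x.
apply/(defect_positive (dm d dg)) => x.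
apply: diff_ge0_limit => t t01.
have t01' (i : 'I_n) : 0 <= t < 1 by case/andP: t01 => /ltW -> ->.
(* Descend from gamma to d at the constant radius t; the start is the choice [weight R gamma]
   itself. *)
apply: (diff_ge0_descend (f0 x) (fM x) gm t01' _ dg) => eta.
rewrite diff_shift; apply: (weighted_defect_positive _ gm).1.
by apply: hyper => [i|i //]; left.
Qed.

End MainTheorem.

Theorem theorem3p7 (R : realType) (H : completeNormedModType R[i])
    (dot : {dot H for Num.conj}) (dot_norm : forall x : H, dot x x = `|x| ^+ 2)
    (n : nat) (T : 'I_n -> {linear H -> H})
    (T_contraction : forall i, contractive_op (T i))
    (T_comm : forall i j (x : H), T i (T j x) = T j (T i x))
    (gamma : mindex n) (gamma_ge1 : forall i, (1 <= gamma i)%N) :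
  contractive_multioperator dot T gamma <-> hypercontraction dot T (weight R gamma).
Proof. exact: contractive_iff_hypercontractive. Qed.
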